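(* A regular elliptical surface with constant curvatures is determined by the invariants $I_{40},I_{31},I_{22},I_{13},I_{04}$ up to (local) affine congruence. That is: let $S,S'\subset A^3$ be regular elliptical surfaces with moving frames for which $I_{40},I_{31},I_{22},I_{13},I_{04}$ are constant on $S$, the corresponding functions are constant on $S'$, and the five constants for $S$ equal those for $S'$. Then for all $P\in S$ and $P'\in S'$ there are a neighbourhood $U$ of $P$ in $S$, a neighbourhood $U'$ of $P'$ in $S'$, and an affine transformation $T\in Aff(3)$ with $T(P)=P'$ and $T(U)=U'$.
   Context: $A^3$ is real affine 3-space, $Aff(3)$ the group of all affine transformations of $A^3$; surfaces are smooth and the theory is local. A surface $S\subset A^3$ is called regular elliptical if for every $P\in S$ there is an affine frame $(e_1,e_2,e_3)$ (a basis of $\mathbb{R}^3$) with origin $P$ such that, in the affine coordinates $(x,y,z)\leftrightarrow P+xe_1+ye_2+ze_3$, $S$ is near $P$ the graph of a function with Taylor expansion $$z=\tfrac12(x^2+y^2)+\tfrac16(x^3-3xy^2)+\sum_{n\ge 4}\frac1{n!}\sum_{i+j=n}I_{ij}\binom{n}{i}x^iy^j .$$ At each point this frame is unique up to a finite group. A moving frame on $S$ is a smooth choice of such a frame (it always exists locally). The coefficients $I_{ij}$ ($i+j\ge4$) are then functions on $S$; $I_{40},I_{31},I_{22},I_{13},I_{04}$ are called the fundamental curvature invariants, and $S$ has constant curvatures if these five are constant. *)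

(* Defs.v *)
From HB Require Import structures.
From mathcomp Require Import all_boot all_order all_algebra.
From mathcomp Require Import all_classical all_reals all_analysis.
Import Order.TTheory GRing.Theory Num.Theory.
Import numFieldNormedType.Exports.

Set Implicit Arguments.
Unset Strict Implicit.
Unset Printing Implicit Defensive.

Local Open Scope classical_set_scope.
Local Open Scope ring_scope.

Section Smoothness.
Context {R : realType}.

Definition pder n (i : 'I_n) (f : 'rV[R]_n -> R) : 'rV[R]_n -> R :=
  fun x => 'D_(delta_mx 0 i) f x.

(* C^oo on a neighbourhood of p.  The neighbourhood is the same for all
   orders; Frechet differentiability of every iterated partial derivative
   includes its continuity. *)
Definition smooth_near n (f : 'rV[R]_n -> R) (p : 'rV[R]_n) : Prop :=
  \forall x \near p, forall s : seq 'I_n, differentiable (foldr (@pder n) f s) x.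

Definition pder2 (i j : nat) (f : 'rV[R]_2 -> R) : 'rV[R]_2 -> R :=
  iter i (pder 0) (iter j (pder 1) f).

Definition taylor_part (n : nat) (f : 'rV[R]_2 -> R) (x y : R) : R :=
  (n`!%:R)^-1 *
  \sum_(i < n.+1) pder2 i (n - i) f 0 * ('C(n, i))%:R * x ^+ i * y ^+ (n - i).

End Smoothness.

Section Surfaces.
Context {R : realType}.

(* A point of A^3 is a row vector; the rows of E : 'M[R]_3 are the frame
   vectors e_1, e_2, e_3. *)
Implicit Types (S U : set 'rV[R]_3) (P : 'rV[R]_3) (E : 'M[R]_3).

Definition affine_point P E (u : 'rV[R]_2) (z : R) : 'rV[R]_3 :=
  P + u 0 0 *: row 0 E + u 0 1 *: row 1 E + z *: row 2 E.

Definition local_graph S P E (f : 'rV[R]_2 -> R) : Prop :=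
  smooth_near f 0 /\
  \forall u \near (0 : 'rV[R]_2) & z \near (0 : R),
    S (affine_point P E u z) <-> z = f u.

Definition adapted_frame S P E : Prop :=
  E \in unitmx /\
  exists f, local_graph S P E f /\
    forall x y : R,
      \sum_(n < 4) taylor_part n f x y =
      1 / 2 * (x ^+ 2 + y ^+ 2) + 1 / 6 * (x ^+ 3 - 3 * x * y ^+ 2).

(* Smoothness of S as an embedded surface is part of the condition, since
   an adapted frame presents S near P as the graph of a smooth function. *)
Definition regular_elliptical S : Prop :=
  forall P, S P -> exists E, adapted_frame S P E.

(* Smooth on S: locally the restriction of a smooth map on an open set of
   A^3.  The values of e off S are irrelevant. *)
Definition smooth_on_surface S (e : 'rV[R]_3 -> 'M[R]_3) : Prop :=
  forall P, S P -> exists F : 'rV[R]_3 -> 'M[R]_3,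
    (forall i j, smooth_near (fun Q => F Q i j) P) /\
    (\forall Q \near P, S Q -> F Q = e Q).

Definition moving_frame S (e : 'rV[R]_3 -> 'M[R]_3) : Prop :=
  (forall P, S P -> adapted_frame S P (e P)) /\ smooth_on_surface S e.

(* At a point with an adapted frame, S determines the germ at 0 of the
   function chosen here, hence all its derivatives at 0. *)
Definition graph_function S P E : 'rV[R]_2 -> R :=
  xget (fun=> 0) [set f | local_graph S P E f].

(* The coefficient of x^i y^j in the expansion is
   I_ij * 'C(n, i) / n! = I_ij / (i! j!) with n = i + j, so that I_ij is the
   partial derivative itself. *)
Definition curv S (e : 'rV[R]_3 -> 'M[R]_3) (i j : nat) P : R :=
  pder2 i j (graph_function S P (e P)) 0.

Definition has_constant_curvatures S (e : 'rV[R]_3 -> 'M[R]_3)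
    (I40 I31 I22 I13 I04 : R) : Prop :=
  forall P, S P ->
    [/\ curv S e 4 0 P = I40, curv S e 3 1 P = I31, curv S e 2 2 P = I22,
        curv S e 1 3 P = I13 & curv S e 0 4 P = I04].

Definition affine_transformation (T : 'rV[R]_3 -> 'rV[R]_3) : Prop :=
  exists (A : 'M[R]_3) (b : 'rV[R]_3),
    A \in unitmx /\ forall v, T v = v *m A + b.

Definition nbhs_in S P U : Prop := U `<=` S /\ within S (nbhs P) U.

End Surfaces.

(* Main.v *)
Require Import Defs.
From mathcomp Require Import all_boot all_order all_algebra.
From mathcomp Require Import all_classical all_reals all_analysis.
From mathcomp Require Import ring lra.
Import Order.TTheory GRing.Theory Num.Theory.
Import numFieldNormedType.Exports.

Set Implicit Arguments.
Unset Strict Implicit.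
Unset Printing Implicit Defensive.

Local Open Scope classical_set_scope.
Local Open Scope ring_scope.

(* The Maurer-Cartan matrix of the moving frame is a constant linear function
   of the coframe.  Indeed, let f be the graph function of S at Q and let the
   graph of g be S at a nearby point, in the frame given there.  Both present
   the same surface; comparing Taylor coefficients of order at most 3, where g
   is in normal form, gives identities between the partial derivatives of f and
   the entries of the frame.  Differentiating them at Q in a tangent direction
   yields nine linear equations for the nine entries of the derivative of the
   frame, whose coefficients involve only the fourth derivatives of f at Q; they
   have a unique solution.

   Hence along each ray t v of the parameter plane, the frame, written in the
   basis e P, solves an ordinary differential equation that depends only on the
   five curvatures, and so does the height of the surface.  Uniqueness of its
   solutions shows that the graph functions of S at P and of S' at P' agree
   near 0, so the affine map carrying one frame to the other carries S to S'. *)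

(** * Calculus *)

Lemma forall_ord3 (P : 'I_3 -> Prop) : P 0 -> P 1 -> P 2 -> forall i, P i.
Proof.
move=> P0 P1 P2 [[|[|[|//]]] hi].
- by rewrite (_ : Ordinal hi = 0)//; exact: val_inj.
- by rewrite (_ : Ordinal hi = 1)//; exact: val_inj.
- by rewrite (_ : Ordinal hi = 2)//; exact: val_inj.
Qed.

Lemma sum_ord3 (R : zmodType) (F : 'I_3 -> R) :
  \sum_i F i = F 0 + F 1 + F 2.
Proof.
rewrite !big_ord_recl big_ord0 addr0 addrA.
by congr (_ + F _ + F _); exact: val_inj.
Qed.

Section Calculus.
Context {R : realType}.

Lemma near_eq_is_derive_unique (f g : R -> R) (t df dg : R) :
  (\forall s \near t, f s = g s) ->
  is_derive t 1 f df -> is_derive t 1 g dg -> df = dg.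
Proof.
by move=> fg [_ <-] [_ <-]; exact: near_eq_derive.
Qed.

Lemma is_derive_comp_row n (F : 'rV[R]_n -> R) (w : R -> 'rV[R]_n) (t : R)
    (dw : 'I_n -> R) :
  differentiable F (w t) ->
  (forall i, is_derive t 1 (fun s => w s 0 i) (dw i)) ->
  is_derive t 1 (fun s => F (w s)) (\sum_i pder i F (w t) * dw i).
Proof.
move=> dF dwP.
have dw0 : derivable w t 1.
  by apply/derivable_mxP => i j; rewrite ord1; case: (dwP j).
have dw1 : differentiable w t by apply/derivable1_diffP.
have wE : 'D_1 w t = \sum_i dw i *: delta_mx 0 i.
  rewrite derive_mx// [LHS]matrix_sum_delta big_ord1.
  by apply: eq_bigr => i _; rewrite !mxE; case: (dwP i) => _ ->.
apply: DeriveDef; first exact/derivable1_diffP/differentiable_comp.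
rewrite deriveE; last exact: differentiable_comp.
rewrite diff_comp//= -[X in 'd F _ X]deriveE// wE linear_sum.
by apply: eq_bigr => i _; rewrite linearZ/= /pder deriveE// mulrC.
Qed.

Lemma is_derive_line n (F : 'rV[R]_n -> R) (q a : 'rV[R]_n) (t : R) :
  differentiable F (q + t *: a) ->
  is_derive t 1 (fun s => F (q + s *: a)) ('D_a F (q + t *: a)).
Proof.
move=> dF.
have dl : is_diff t (fun s : R => q + s *: a) (0 + *:%R^~ a) by exact: is_diffD.
have dl' : differentiable (fun s : R => q + s *: a) t by exact: ex_diff.
apply: DeriveDef; first exact/derivable1_diffP/differentiable_comp.
rewrite deriveE; last exact: differentiable_comp.
by rewrite diff_comp//= [RHS]deriveE// [X in _ (X 1)]diff_val/= add0r scale1r.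
Qed.

(* The left-hand side is symmetric in a and b, up to the last term; dividing by
   h^2 therefore gives the symmetry of second derivatives. *)
Lemma second_difference n (f : 'rV[R]_n -> R) (p a b : 'rV[R]_n) (e : R) :
  0 < e -> (\forall x \near p, differentiable f x) ->
  differentiable ('D_a f) p ->
  \forall h \near 0^'+,
    `|f (p + h *: a + h *: b) - f (p + h *: a) - f (p + h *: b) + f p
      - h ^+ 2 * 'D_b ('D_a f) p| <= e * h ^+ 2.
Proof.
move=> e0 df dG; set G := 'D_a f.
pose c := `|a| + `|b|.
have c0 : 0 <= c by rewrite addr_ge0.
have /eqaddoP/= := funext (diff_locallyxC dG).
(* Two first-order remainders of [G] will each be at most this tolerance times [h * (c + 1)];
   multiplied by [h], they add up to [e * h ^+ 2]. Using [c + 1] instead of [c] keeps the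
   denominator positive when [a = b = 0]. *)
have e'0 : 0 < e / (2 * (c + 1)) by rewrite divr_gt0// mulr_gt0// ltr_wpDl.
move=> /(_ _ e'0) /nbhs_ballP [r /= r0 rP].
move: df => /nbhs_ballP [d /= d0 dP].
have inb x : `|x| < d -> differentiable f (p + x).
  move=> xd; apply: dP; rewrite -ball_normE /= opprD addrA subrr sub0r normrN.
  exact: xd.
near=> h.
have h0 : 0 < h by [].
have hc : h * (c + 1) < Num.min r d.
  rewrite -ltr_pdivlMr ?ltr_wpDl//; near: h; apply: nbhs_right_lt.
  by rewrite divr_gt0 ?ltr_wpDl// lt_min r0.
have lin (s : R) (x : 'rV[R]_n) : `|s| <= h -> `|x| <= h * `|b| ->
    `|s *: a + x| < Num.min r d.
  move=> sh xh; apply: le_lt_trans hc; rewrite (le_trans (ler_normD _ _))//.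
  rewrite normrZ mulrDr mulr1 /c mulrDr -addrA lerD//; first exact: ler_wpM2r.
  by rewrite (le_trans xh)// lerDl ltW.
have bh : `|h *: b| <= h * `|b| by rewrite normrZ gtr0_norm.
have z0 : `|0 : 'rV[R]_n| <= h * `|b| by rewrite normr0 mulr_ge0// ltW.
(* The second difference is [g h - g 0], hence [h * g' x] for an intermediate [x]. Both terms of
   [g' x] are then expanded to first order at [p], where the contribution of [x *: a] cancels and
   [h * 'D_b G p] remains. *)
pose g (s : R) : R := f (p + h *: b + s *: a) - f (p + s *: a).
pose g' (s : R) : R := G (p + h *: b + s *: a) - G (p + s *: a).
have gd (s : R) : `|s| <= h -> is_derive s 1 g (g' s).
  move=> sh; apply: is_deriveB; apply: is_derive_line.
    rewrite -addrA [h *: b + _]addrC; apply: inb.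
    by have := lin _ _ sh bh; rewrite lt_min => /andP[].
  by apply: inb; have := lin _ _ sh z0; rewrite addr0 lt_min => /andP[].
have itvn (s : R) : s \in `[0, h] -> `|s| <= h.
  by rewrite in_itv/= => /andP[s0 sh]; rewrite ger0_norm.
have [||x xh] := @MVT R g g' 0 h h0.
- by move=> s sh; apply: gd; apply: itvn; exact: subset_itv_oo_cc.
- apply: derivable_within_continuous => s sh.
  by have [] := gd _ (itvn _ sh).
have {}xh : `|x| <= h by apply: itvn; exact: subset_itv_oo_cc.
rewrite subr0 /g !scale0r !addr0 => gE.
rewrite (_ : _ + f p = g' x * h); last first.
  by rewrite -gE [p + h *: a + _]addrAC; ring.
have rem (s : R) (y : 'rV[R]_n) : `|s| <= h -> `|y| <= h * `|b| ->
    `|G (p + (s *: a + y)) - (G p + 'd G p (s *: a + y))|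
      <= e / (2 * (c + 1)) * (h * (c + 1)).
  move=> sh yh; have sy := lin _ _ sh yh.
  apply: le_trans (rP _ _) _ => /=.
    rewrite -ball_normE /= sub0r normrN.
    by move: sy; rewrite lt_min => /andP[].
  apply: ler_wpM2l; first exact: ltW.
  rewrite (le_trans (ler_normD _ _))// normrZ mulrDr mulr1 /c mulrDr -addrA.
  by rewrite lerD//; [exact: ler_wpM2r|rewrite (le_trans yh)// lerDl ltW].
have r1 := rem _ _ xh bh; have r2 := rem _ _ xh z0.
have dGb : 'd G p (x *: a + h *: b) = 'd G p (x *: a) + h * 'D_b G p.
  by rewrite linearD [X in _ + X]linearZ/= deriveE.
rewrite dGb in r1; rewrite addr0 in r2.
rewrite /g' -addrA [h *: b + _]addrC.
move: r1 r2; set A := G _; set B := G (p + x *: a).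
set L := 'd G p _; set D := 'D_b G p => r1 r2.
have ->: (A - B) * h - h ^+ 2 * D
   = h * ((A - (G p + (L + h * D))) - (B - (G p + L))) by ring.
have -> : e * h ^+ 2 = h * (e / (2 * (c + 1)) * (h * (c + 1)) +
    e / (2 * (c + 1)) * (h * (c + 1))).
  by field; rewrite gt_eqF// ltr_wpDl.
rewrite normrM gtr0_norm//; apply: ler_wpM2l; first exact: ltW.
by rewrite (le_trans (ler_normB _ _))// lerD.
Unshelve. all: by end_near. Qed.

Lemma derive_comm n (f : 'rV[R]_n -> R) (p a b : 'rV[R]_n) :
  (\forall x \near p, differentiable f x) ->
  differentiable ('D_a f) p -> differentiable ('D_b f) p ->
  'D_b ('D_a f) p = 'D_a ('D_b f) p.
Proof.
move=> df da db; apply/eqP; rewrite -subr_eq0 -normr_le0.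
apply/ler_addgt0Pr => e e0; rewrite add0r.
have e2 : 0 < e / 2 by rewrite divr_gt0.
have dA := second_difference b e2 df da.
have dB := second_difference a e2 df db.
near (0 : R)^'+ => h.
have h2 : 0 < h ^+ 2 by rewrite exprn_gt0.
have := near dA h; move=> /(_ _)/wrap[//|A].
have := near dB h; move=> /(_ _)/wrap[//|B].
rewrite [p + h *: b + _]addrAC in B.
set X := 'D_b _ _ in A *; set Y := 'D_a _ _ in B *.
suff: `|(X - Y) * h ^+ 2| <= e * h ^+ 2.
  by rewrite normrM (gtr0_norm h2) ler_pM2r.
set F := f _ in A B; set F1 := f _ in A B; set F2 := f _ in A B.
have -> : (X - Y) * h ^+ 2 = (F - F2 - F1 + f p - h ^+ 2 * Y) -
   (F - F1 - F2 + f p - h ^+ 2 * X) by ring.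
rewrite (le_trans (ler_normB _ _))// (le_trans (lerD B A))//.
by rewrite -mulrDl -splitr.
Unshelve. all: by end_near. Qed.

Lemma smooth_near_near n (f : 'rV[R]_n -> R) p :
  smooth_near f p -> \forall x \near p, smooth_near f x.
Proof. exact: near_join. Qed.

Lemma smooth_near_diff n (f : 'rV[R]_n -> R) p :
  smooth_near f p -> differentiable f p.
Proof. by move=> /nbhs_singleton /(_ [::]). Qed.

Lemma smooth_near_pder n (f : 'rV[R]_n -> R) p i :
  smooth_near f p -> smooth_near (pder i f) p.
Proof.
apply: filterS => x + s => /(_ (rcons s i)).
by rewrite -cats1 foldr_cat.
Qed.

Lemma smooth_near_pder2 (f : 'rV[R]_2 -> R) p i j :
  smooth_near f p -> smooth_near (pder2 i j f) p.
Proof.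
move=> fs; rewrite /pder2; elim: i => [|i IH] /=; last exact: smooth_near_pder.
by elim: j => [//|j IH] /=; exact: smooth_near_pder.
Qed.

(** [pder2] differentiates in the second variable first, so a further such derivative has to be
    commuted past the [i] outer ones. The induction is uniform in [p] because each commutation needs
    the previous case on a neighbourhood. *)
Lemma pder1_pder2 (f : 'rV[R]_2 -> R) p i j :
  smooth_near f p -> pder 1 (pder2 i j f) p = pder2 i j.+1 f p.
Proof.
elim: i p => [//|i IH] p fs.
rewrite /pder2 iterS -/(pder2 i j f) [RHS]/(pder 0 (pder2 i j.+1 f) p).
have gs : smooth_near (pder2 i j f) p by exact: smooth_near_pder2.
transitivity (pder 0 (pder 1 (pder2 i j f)) p).
  apply: derive_comm.
  - by apply: filterS (smooth_near_near gs) => x /smooth_near_diff.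
  - exact/smooth_near_diff/smooth_near_pder.
  - exact/smooth_near_diff/smooth_near_pder.
by apply: near_eq_derive; apply: filterS (smooth_near_near fs) => x /IH.
Qed.

End Calculus.

(** * Derivatives along curves in the parameter plane *)

Section Curves.
Context {R : realType}.

Definition vec2 (x y : R) : 'rV[R]_2 := \row_i (if i == 0 then x else y).

Lemma vec2_0 (x y : R) : vec2 x y 0 0 = x. Proof. by rewrite mxE. Qed.

Lemma vec2_1 (x y : R) : vec2 x y 0 1 = y. Proof. by rewrite mxE. Qed.

Lemma vec2_eta (u : 'rV[R]_2) : u = vec2 (u 0 0) (u 0 1).
Proof.
by apply/rowP => i; case: i => [[|[|//]] hi]; rewrite !mxE /=;
  congr (u _ _); exact: val_inj.
Qed.

Lemma is_derive_comp_vec2 (F : 'rV[R]_2 -> R) (x y : R -> R) (t dx dy : R) :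
  differentiable F (vec2 (x t) (y t)) ->
  is_derive t 1 x dx -> is_derive t 1 y dy ->
  is_derive t 1 (fun s => F (vec2 (x s) (y s)))
    (pder 0 F (vec2 (x t) (y t)) * dx + pder 1 F (vec2 (x t) (y t)) * dy).
Proof.
move=> dF dxP dyP.
have := @is_derive_comp_row R 2 F (fun s => vec2 (x s) (y s)) t
  (fun i => if i == 0 then dx else dy) dF.
rewrite !big_ord_recl big_ord0 /= addr0 (_ : lift ord0 ord0 = 1).
  apply=> i; under eq_fun do rewrite mxE.
  by case: ifP.
exact: val_inj.
Qed.

Lemma is_derive_pder2 (f : 'rV[R]_2 -> R) i j (x y : R -> R) (t dx dy : R) :
  smooth_near f (vec2 (x t) (y t)) ->
  is_derive t 1 x dx -> is_derive t 1 y dy ->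
  is_derive t 1 (fun s => pder2 i j f (vec2 (x s) (y s)))
    (pder2 i.+1 j f (vec2 (x t) (y t)) * dx +
     pder2 i j.+1 f (vec2 (x t) (y t)) * dy).
Proof.
move=> fs dxP dyP; rewrite -(@pder1_pder2 _ f _ i j fs).
apply: is_derive_comp_vec2 => //.
exact/smooth_near_diff/smooth_near_pder2.
Qed.

Lemma is_derive_add (f g : R -> R) (t df dg : R) :
  is_derive t 1 f df -> is_derive t 1 g dg ->
  is_derive t 1 (fun s => f s + g s) (df + dg).
Proof. by move=> *; exact: (@is_deriveD _ _ _ f g). Qed.

Lemma is_derive_mul (f g : R -> R) (t df dg : R) :
  is_derive t 1 f df -> is_derive t 1 g dg ->
  is_derive t 1 (fun s => f s * g s) (df * g t + f t * dg).
Proof.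
move=> fd gd; have := is_deriveM fd gd.
by rewrite /GRing.scale/= addrC [g t * _]mulrC.
Qed.

Lemma is_derive_const (c t : R) : is_derive t 1 (fun=> c) 0.
Proof. exact: is_derive_cst. Qed.

Lemma is_derive_continuous (f : R -> R) (t df : R) :
  is_derive t 1 f df -> {for t, continuous f}.
Proof. by move=> [/derivable1_diffP/differentiable_continuous]. Qed.

Lemma continuous_vec2 (x y : R -> R) (t : R) :
  {for t, continuous x} -> {for t, continuous y} ->
  {for t, continuous (fun s => vec2 (x s) (y s))}.
Proof.
move=> xc yc; apply/cvgrPdist_lt => e e0.
have {}xc : \forall s \near t, `|x t - x s| < e.
  by move/cvgrPdist_lt : xc => /(_ e e0).
have {}yc : \forall s \near t, `|y t - y s| < e.
  by move/cvgrPdist_lt : yc => /(_ e e0).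
near=> s; rewrite /Num.Def.normr/= mx_normrE.
apply/bigmax_ltP; split=> // -[i j] _; rewrite !mxE/=.
by case: ifP => _; near: s.
Unshelve. all: by end_near. Qed.

End Curves.

(** * Derivatives up to order three of a function composed with a plane curve *)

Section Jets.
Context {R : realType}.

Section Faa.
Variables (D : nat -> nat -> R -> R) (x y : nat -> R -> R).

(* First, second and third derivatives of D 0 0 along the curve (x 0, y 0), when
   D i j is the (i, j)-th partial derivative restricted to that curve and x n,
   y n are the n-th derivatives of the coordinates. *)
Definition comp_der1 (t : R) : R :=
  D 1%N 0%N t * x 1%N t + D 0%N 1%N t * y 1%N t.
Definition comp_der2 (t : R) : R :=
  D 2%N 0%N t * x 1%N t * x 1%N t +
  2%:R * D 1%N 1%N t * x 1%N t * y 1%N t + D 0%N 2%N t * y 1%N t * y 1%N t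
  + D 1%N 0%N t * x 2%N t + D 0%N 1%N t * y 2%N t.
Definition comp_der3 (t : R) : R :=
  D 3%N 0%N t * x 1%N t * x 1%N t * x 1%N t +
  3%:R * D 2%N 1%N t * x 1%N t * x 1%N t * y 1%N t
  + 3%:R * D 1%N 2%N t * x 1%N t * y 1%N t * y 1%N t
  + D 0%N 3%N t * y 1%N t * y 1%N t * y 1%N t
  + 3%:R * (D 2%N 0%N t * x 1%N t * x 2%N t
    + D 1%N 1%N t * (x 1%N t * y 2%N t + x 2%N t * y 1%N t)
    + D 0%N 2%N t * y 1%N t * y 2%N t)
  + D 1%N 0%N t * x 3%N t + D 0%N 1%N t * y 3%N t.

Lemma is_derive_comp_der (t : R) :
  (forall n, (n < 3)%N -> is_derive t 1 (x n) (x n.+1 t)) ->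
  (forall n, (n < 3)%N -> is_derive t 1 (y n) (y n.+1 t)) ->
  (forall i j, is_derive t 1 (D i j)
     (D i.+1 j t * x 1%N t + D i j.+1 t * y 1%N t)) ->
  is_derive t 1 comp_der1 (comp_der2 t) /\
  is_derive t 1 comp_der2 (comp_der3 t).
Proof.
move=> dx dy dD.
have dx1 := dx 1%N isT; have dx2 := dx 2%N isT.
have dy1 := dy 1%N isT; have dy2 := dy 2%N isT.
split.
- rewrite /comp_der1; apply: is_derive_eq.
  by rewrite /comp_der2 /GRing.scale/=; ring.
- rewrite /comp_der2; apply: is_derive_eq.
  by rewrite /comp_der3 /GRing.scale/=; ring.
Qed.

End Faa.

Section Composition.
Variables (f : 'rV[R]_2 -> R) (x y z : nat -> R -> R).
Hypothesis fs : smooth_near f (vec2 (x 0%N 0) (y 0%N 0)).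
Hypothesis dx : forall n, (n < 3)%N ->
  \forall t \near 0, is_derive (t : R) 1 (x n) (x n.+1 t).
Hypothesis dy : forall n, (n < 3)%N ->
  \forall t \near 0, is_derive (t : R) 1 (y n) (y n.+1 t).

Let D i j (t : R) : R := pder2 i j f (vec2 (x 0%N t) (y 0%N t)).

Lemma comp_derivatives : \forall t \near 0,
  [/\ is_derive (t : R) 1 (D 0%N 0%N) (comp_der1 D x y t),
      is_derive t 1 (comp_der1 D x y) (comp_der2 D x y t) &
      is_derive t 1 (comp_der2 D x y) (comp_der3 D x y t)].
Proof.
have x0 : {for 0, continuous (x 0%N)}.
  by have /nbhs_singleton/is_derive_continuous := dx (isT : 0 < 3)%N.
have y0 : {for 0, continuous (y 0%N)}.
  by have /nbhs_singleton/is_derive_continuous := dy (isT : 0 < 3)%N.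
have := continuous_vec2 x0 y0 => /(_ _ (smooth_near_near fs)) fsn.
have dx0 := dx (isT : 0 < 3)%N; have dx1 := dx (isT : 1 < 3)%N.
have dx2 := dx (isT : 2 < 3)%N; have dy0 := dy (isT : 0 < 3)%N.
have dy1 := dy (isT : 1 < 3)%N; have dy2 := dy (isT : 2 < 3)%N.
near=> t.
have ft : smooth_near f (vec2 (x 0%N t) (y 0%N t)) by near: t.
have xt n : (n < 3)%N -> is_derive t 1 (x n) (x n.+1 t).
  by case: n => [|[|[|//]]] _; near: t.
have yt n : (n < 3)%N -> is_derive t 1 (y n) (y n.+1 t).
  by case: n => [|[|[|//]]] _; near: t.
have Dt i j : is_derive t 1 (D i j)
     (D i.+1 j t * x 1%N t + D i j.+1 t * y 1%N t).
  by apply: is_derive_pder2 => //; [exact: xt|exact: yt].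
by have [] := is_derive_comp_der xt yt Dt.
Unshelve. all: by end_near. Qed.

Hypothesis dz : forall n, (n < 3)%N ->
  \forall t \near 0, is_derive (t : R) 1 (z n) (z n.+1 t).

(** An equality valid near 0 is valid near every nearby [t], so it may be differentiated there and
    the result again holds near 0. The third derivatives are compared only at 0 itself. *)
Lemma comp_eq_derivatives :
  (\forall t \near 0, f (vec2 (x 0%N t) (y 0%N t)) = z 0%N t) ->
  [/\ comp_der1 D x y 0 = z 1%N 0, comp_der2 D x y 0 = z 2%N 0 &
      comp_der3 D x y 0 = z 3%N 0].
Proof.
move=> e0; have cd := comp_derivatives.
have dz0 := dz (isT : 0 < 3)%N; have dz1 := dz (isT : 1 < 3)%N.
have e1 : \forall t \near 0, comp_der1 D x y t = z 1%N t.
  have e0' := near_join e0.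
  apply: filterS3 e0' cd dz0 => t et [d1 _ _] dzt.
  exact: near_eq_is_derive_unique et d1 dzt.
have e2 : \forall t \near 0, comp_der2 D x y t = z 2%N t.
  have e1' := near_join e1.
  apply: filterS3 e1' cd dz1 => t et [_ d2 _] dzt.
  exact: near_eq_is_derive_unique et d2 dzt.
split; [exact: nbhs_singleton e1|exact: nbhs_singleton e2|].
have [_ _ d3] := nbhs_singleton cd.
exact: (near_eq_is_derive_unique e2 d3 (nbhs_singleton (dz _))).
Qed.

End Composition.
End Jets.

(** * The derivative of an adapted frame *)

Section Transfer.
Context {R : realType}.

(** These are the partial derivatives at the origin, up to order 3, of
    [(x^2 + y^2) / 2 + (x^3 - 3 x y^2) / 6]. *)
Definition normal_jet (d : nat -> nat -> R) : Prop :=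
  [/\ d 0%N 0%N = 0, d 1%N 0%N = 0, d 0%N 1%N = 0,
      d 2%N 0%N = 1 & d 1%N 1%N = 0] /\
  [/\ d 0%N 2%N = 1, d 3%N 0%N = 1, d 2%N 1%N = 0,
      d 1%N 2%N = -1 & d 0%N 3%N = 0].

(* Substitute h = t k into
   f (u + h.a + g h a_2) = f u + h.b + g h b_2, where row i of m is (a_i, b_i)
   and g is in normal form; these are the coefficients of t, t^2 and t^3, with
   d the partial derivatives of f at u. *)
Definition jet_eq (d : nat -> nat -> R) (m : 'I_3 -> 'I_3 -> R) (k0 k1 : R) :
    Prop :=
  let a j := k0 * m 0 j + k1 * m 1 j in
  let q := k0 * k0 + k1 * k1 in
  let c := k0 * k0 * k0 - 3%:R * (k0 * k1 * k1) in
  [/\ d 1%N 0%N * a 0 + d 0%N 1%N * a 1 = a 2,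
      d 2%N 0%N * (a 0 * a 0) + 2%:R * d 1%N 1%N * (a 0 * a 1)
        + d 0%N 2%N * (a 1 * a 1)
        + q * (d 1%N 0%N * m 2 0 + d 0%N 1%N * m 2 1) = q * m 2 2 &
      d 3%N 0%N * (a 0 * a 0 * a 0) + 3%:R * d 2%N 1%N * (a 0 * a 0 * a 1)
        + 3%:R * d 1%N 2%N * (a 0 * a 1 * a 1) + d 0%N 3%N * (a 1 * a 1 * a 1)
        + 3%:R * q * (d 2%N 0%N * (a 0 * m 2 0)
            + d 1%N 1%N * (a 0 * m 2 1 + a 1 * m 2 0)
            + d 0%N 2%N * (a 1 * m 2 1))
        + c * (d 1%N 0%N * m 2 0 + d 0%N 1%N * m 2 1) = c * m 2 2].

(* The n-th derivative of t |-> c + t a + phi_0 t b, where phi_n is the n-th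
   derivative of phi_0. *)
Definition affine_curve (c a b : R) (phi : nat -> R -> R) (n : nat) (t : R) :
    R :=
  match n with
  | 0 => c + t * a + phi 0%N t * b
  | 1 => a + phi 1%N t * b
  | n => phi n t * b
  end.

Lemma is_derive_affine_curve (c a b : R) (phi : nat -> R -> R) (t : R) n :
  is_derive t 1 (phi n) (phi n.+1 t) ->
  is_derive t 1 (affine_curve c a b phi n) (affine_curve c a b phi n.+1 t).
Proof.
by case: n => [|[|n]] dphi; cbv beta iota delta [affine_curve];
  apply: is_derive_eq; rewrite /GRing.scale/=; ring.
Qed.

Lemma jet_transfer (f g : 'rV[R]_2 -> R) (u0 u1 : R) (m : 'I_3 -> 'I_3 -> R) :
  smooth_near f (vec2 u0 u1) -> smooth_near g (vec2 0 0) ->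
  normal_jet (fun i j => pder2 i j g (vec2 0 0)) ->
  (\forall h \near (vec2 0 0 : 'rV[R]_2),
     f (vec2 (u0 + ((h : 'rV[R]_2) 0 0 * m 0 0 + h 0 1 * m 1 0) + g h * m 2 0)
             (u1 + (h 0 0 * m 0 1 + h 0 1 * m 1 1) + g h * m 2 1))
     = f (vec2 u0 u1) + (h 0 0 * m 0 2 + h 0 1 * m 1 2) + g h * m 2 2) ->
  forall k0 k1, jet_eq (fun i j => pder2 i j f (vec2 u0 u1)) m k0 k1.
Proof.
move=> fs gs [[g00 g10 g01 g20 g11] [g02 g30 g21 g12 g03]] fg k0 k1.
(* The line [t k] together with its derivatives, obtained as an affine curve with zero [phi]. *)
pose l k : nat -> R -> R := affine_curve 0 k 0 (fun _ _ => 0).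
have dl k n : (n < 3)%N ->
    \forall t \near 0, is_derive (t : R) 1 (l k n) (l k n.+1 t).
  by move=> _; near=> t; apply: is_derive_affine_curve; exact: is_derive_const.
have l0 k : l k 0%N 0 = 0 by rewrite /l/=; ring.
have gs' : smooth_near g (vec2 (l k0 0%N 0) (l k1 0%N 0)) by rewrite !l0.
have gd := comp_derivatives gs' (dl k0) (dl k1).
pose G i j (t : R) : R := pder2 i j g (vec2 (l k0 0%N t) (l k1 0%N t)).
(* The successive derivatives of [t |-> g (t k0, t k1)]. By the normal form of [g], their values at
   0 are 0, 0 and the quantities [q] and [c] of [jet_eq]. *)
pose phi n := match n with
  | 0 => G 0%N 0%N
  | 1 => comp_der1 G (l k0) (l k1)
  | 2 => comp_der2 G (l k0) (l k1)
  | _ => comp_der3 G (l k0) (l k1) end%N.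
have dphi n : (n < 3)%N ->
    \forall t \near 0, is_derive (t : R) 1 (phi n) (phi n.+1 t).
  by case: n => [|[|[|//]]] _; apply: filterS gd => t [].
pose ac c a b := affine_curve c a b phi.
have dac c a b n : (n < 3)%N ->
    \forall t \near 0, is_derive (t : R) 1 (ac c a b n) (ac c a b n.+1 t).
  by move=> /dphi; apply: filterS => t; exact: is_derive_affine_curve.
pose a j := k0 * m 0 j + k1 * m 1 j.
have G0 i j : G i j 0 = pder2 i j g (vec2 0 0) by rewrite /G !l0.
have phi0 : phi 0%N 0 = 0 by rewrite /= G0.
have phi1 : phi 1%N 0 = 0 by rewrite /= /comp_der1 !G0 g10 g01; ring.
have phi2 : phi 2%N 0 = k0 * k0 + k1 * k1.
  by rewrite /= /comp_der2 !G0 g10 g01 g20 g11 g02 /l/=; ring.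
have phi3 : phi 3%N 0 = k0 * k0 * k0 - 3%:R * (k0 * k1 * k1).
  by rewrite /= /comp_der3 !G0 g10 g01 g20 g11 g02 g30 g21 g12 g03 /l/=; ring.
have ac0 c b j : ac c (a j) b 0%N 0 = c by rewrite /ac /affine_curve phi0; ring.
have fs' : smooth_near f
    (vec2 (ac u0 (a 0) (m 2 0) 0%N 0) (ac u1 (a 1) (m 2 1) 0%N 0)).
  by rewrite !ac0.
have := @comp_eq_derivatives R f _ _ (ac (f (vec2 u0 u1)) (a 2) (m 2 2)) fs'
  (dac _ _ _) (dac _ _ _) (dac _ _ _).
case.
  have lc k : {for 0, continuous (l k 0%N)}.
    by have /nbhs_singleton/is_derive_continuous := dl k 0%N isT.
  have lim : (fun t => vec2 (l k0 0%N t) (l k1 0%N t)) @ (0 : R) --> vec2 0 0.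
    have -> : vec2 0 0 = vec2 (l k0 0%N 0) (l k1 0%N 0) by rewrite !l0.
    exact: continuous_vec2 (lc k0) (lc k1).
  have := lim _ fg; apply: (@filterS _ (nbhs (0 : R))) => t.
  rewrite /preimage/mkset !vec2_0 !vec2_1.
  have lt k : l k 0%N t = t * k by rewrite /l/=; ring.
  have phit : phi 0%N t = g (vec2 (t * k0) (t * k1)) by rewrite -!lt.
  rewrite !lt /ac /affine_curve phit.
  have -> : u0 + t * a 0 = u0 + (t * k0 * m 0 0 + t * k1 * m 1 0).
    by rewrite /a; ring.
  have -> : u1 + t * a 1 = u1 + (t * k0 * m 0 1 + t * k1 * m 1 1).
    by rewrite /a; ring.
  move=> ->; rewrite /a; set F := f _; set F' := g _; ring.
rewrite /comp_der1 /comp_der2 /comp_der3 !ac0.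
set D := fun i j => pder2 i j f (vec2 u0 u1).
rewrite -![pder2 _ _ f _]/(D _ _).
have ac1 c b j : ac c (a j) b 1%N 0 = a j.
  by rewrite /ac /affine_curve phi1; ring.
have ac2 c b j : ac c (a j) b 2%N 0 = (k0 * k0 + k1 * k1) * b.
  by rewrite /ac /affine_curve phi2.
have ac3 c b j : ac c (a j) b 3%N 0 =
    (k0 * k0 * k0 - 3%:R * (k0 * k1 * k1)) * b.
  by rewrite /ac /affine_curve phi3.
rewrite !ac1 !ac2 !ac3 => e1 e2 e3.
move: D e1 e2 e3 => D e1 e2 e3; split; rewrite -/(a 0) -/(a 1) -/(a 2).
- by [].
- by rewrite -e2; ring.
- by rewrite -e3; ring.
Unshelve. all: by end_near. Qed.

End Transfer.

(** * The linear equations for the derivative of the frame *)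

Section Linearization.
Context {R : realType}.
Variables (I40 I31 I22 I13 I04 : R).

(* The unique solution dm of the equations obtained by differentiating jet_eq at
   the origin of the graph in the direction (v0, v1). *)
Definition connection (v0 v1 : R) (i j : 'I_3) : R :=
  let p0 := v0 * I40 + v1 * I31 in let p1 := v0 * I31 + v1 * I22 in
  let p2 := v0 * I22 + v1 * I13 in let p3 := v0 * I13 + v1 * I04 in
  let b := (3 * p2 - p0) / 2 in
  let a10 := (v1 - (3 * p1 - p3) / 6) / 2 in
  match val i, val j with
  | 0%N, 0%N => (b - v0) / 2
  | 0%N, 1%N => v1 - a10
  | 0%N, _ => v0
  | 1%N, 0%N => a10
  | 1%N, 1%N => (b + v0) / 2
  | 1%N, _ => v1
  | _, 0%N => (b - p0 - 3 * ((b - v0) / 2)) / 3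
  | _, 1%N => a10 - p3 / 3
  | _, _ => b
  end.

Lemma near_and3 (A B C : R -> Prop) (t : R) :
  (\forall s \near t, [/\ A s, B s & C s]) ->
  [/\ (\forall s \near t, A s), (\forall s \near t, B s)
    & \forall s \near t, C s].
Proof. by move=> H; split; apply: filterS H => s []. Qed.

Lemma linearization (d : nat -> nat -> R -> R) (m : 'I_3 -> 'I_3 -> R -> R)
    (dm : 'I_3 -> 'I_3 -> R) (t v0 v1 : R) :
  (forall i j, is_derive t 1 (d i j) (d i.+1 j t * v0 + d i j.+1 t * v1)) ->
  (forall i j, is_derive t 1 (m i j) (dm i j)) ->
  normal_jet (fun i j => d i j t) ->
  d 4%N 0%N t = I40 -> d 3%N 1%N t = I31 -> d 2%N 2%N t = I22 ->
  d 1%N 3%N t = I13 -> d 0%N 4%N t = I04 ->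
  (forall i j, m i j t = (i == j)%:R) ->
  (\forall s \near t, forall k0 k1,
     jet_eq (fun i j => d i j s) (fun i j => m i j s) k0 k1) ->
  forall i j, dm i j = connection v0 v1 i j.
Proof.
move=> dd dmP [[d00 d10 d01 d20 d11] [d02 d30 d21 d12 d03]] d40 d31 d22 d13 d04.
move=> m0 eqs.
have m00 : m 0 0 t = 1 by rewrite m0.
have m01 : m 0 1 t = 0 by rewrite m0.
have m02 : m 0 2 t = 0 by rewrite m0.
have m10 : m 1 0 t = 0 by rewrite m0.
have m11 : m 1 1 t = 1 by rewrite m0.
have m12 : m 1 2 t = 0 by rewrite m0.
have m20 : m 2 0 t = 0 by rewrite m0.
have m21 : m 2 1 t = 0 by rewrite m0.
have m22 : m 2 2 t = 1 by rewrite m0.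
pose E := (m00, m01, m02, m10, m11, m12, m20, m21, m22,
  (d00, d10, d01, d20, d11, d02, d30, d21, d12, d03),
  (d40, d31, d22, d13, d04)).
(* The derivatives at [t] of the three equations of [jet_eq] for fixed [k0], [k1]. Since [m] is the
   identity and [d] is in normal form at [t], they are linear in [dm]. *)
have lin k0 k1 :
  [/\ k0 * v0 + k1 * v1 = k0 * dm 0 2 + k1 * dm 1 2,
   v0 * (k0 * k0 - k1 * k1) - 2 * v1 * k0 * k1
     + 2 * (k0 * (k0 * dm 0 0 + k1 * dm 1 0) + k1 * (k0 * dm 0 1 + k1 * dm 1 1))
     = (k0 * k0 + k1 * k1) * dm 2 2 &
   (I40 * v0 + I31 * v1) * (k0 * k0 * k0)
   + 3 * (I31 * v0 + I22 * v1) * (k0 * k0 * k1)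
   + 3 * (I22 * v0 + I13 * v1) * (k0 * k1 * k1)
   + (I13 * v0 + I04 * v1) * (k1 * k1 * k1)
   + 3 * ((k0 * k0 - k1 * k1) * (k0 * dm 0 0 + k1 * dm 1 0)
     - 2 * k0 * k1 * (k0 * dm 0 1 + k1 * dm 1 1))
   + 3 * (k0 * k0 + k1 * k1) * (k0 * dm 2 0 + k1 * dm 2 1)
   = (k0 * k0 * k0 - 3 * (k0 * k1 * k1)) * dm 2 2].
  have := @filterS _ (nbhs t) _ _ _ (fun s H => H k0 k1) eqs.
  rewrite /jet_eq => /(_ _)/near_and3[e1 e2 e3].
  have H1 := @near_eq_derive R R R _ _ _ 1 e1.
  have H2 := @near_eq_derive R R R _ _ _ 1 e2.
  have H3 := @near_eq_derive R R R _ _ _ 1 e3.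
  rewrite !derive_val /GRing.scale/= !E in H1 H2 H3.
  by split; lra.
(* The three equations are a linear, a quadratic and a cubic form in [(k0, k1)], with 2, 3 and 4
   coefficients. Values at that many pairwise independent vectors determine them, which gives nine
   equations for the nine entries of [dm]. *)
have [l1 l2 l3] := lin 1 0; have [l4 l5 l6] := lin 0 1.
have [_ l7 l8] := lin 1 1; have [_ _ l9] := lin 1 (-1).
by apply: forall_ord3; apply: forall_ord3; rewrite /connection/=; lra.
Qed.

End Linearization.

(** * Graphs in an affine frame *)

Section Frames.
Context {R : realType}.
Implicit Types (S : set 'rV[R]_3) (P Q : 'rV[R]_3) (E : 'M[R]_3).
Implicit Types (f g : 'rV[R]_2 -> R).

Lemma entry_le_norm m n (A : 'M[R]_(m, n)) i j : `|A i j| <= `|A|.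
Proof.
rewrite [leRHS]/Num.Def.normr/= mx_normrE.
exact: (@le_bigmax _ _ _ _ (fun ij => `|A ij.1 ij.2|) (i, j)).
Qed.

Definition vec3 (x y z : R) : 'rV[R]_3 :=
  \row_i (if i == 0 then x else if i == 1 then y else z).

Definition horiz (c : 'rV[R]_3) : 'rV[R]_2 := vec2 (c 0 0) (c 0 1).

Lemma vec3_eta (c : 'rV[R]_3) : c = vec3 (c 0 0) (c 0 1) (c 0 2).
Proof. by apply/rowP; apply: forall_ord3; rewrite !mxE. Qed.

Lemma vec2_00 : vec2 0 0 = 0 :> 'rV[R]_2.
Proof. by apply/rowP => i; rewrite !mxE; case: ifP. Qed.

Lemma horiz_norm c : `|horiz c| <= `|c|.
Proof.
rewrite [leLHS]/Num.Def.normr/= mx_normrE bigmax_le// => -[i j] _.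
by rewrite !mxE/=; case: ifP => _; exact: entry_le_norm.
Qed.

Lemma cvg_mx m n (T : Type) (F : set_system T) {FF : Filter F}
    (w : T -> 'M[R]_(m, n)) (l : 'M[R]_(m, n)) :
  (forall i j, w s i j @[s --> F] --> l i j) -> w s @[s --> F] --> l.
Proof.
move=> wl; apply/(@cvgrPdist_lt R) => e e0.
have : \forall s \near F, forall i j, `|l i j - w s i j| < e.
  apply: filter_forall => i; apply: filter_forall => j.
  by have /cvgrPdist_lt/(_ e e0) := wl i j.
apply: filterS => s ws; rewrite /Num.Def.normr/= mx_normrE.
by apply/bigmax_ltP; split=> // -[i j] _; rewrite !mxE/=.
Qed.

Lemma affine_pointE P E (u : 'rV[R]_2) (z : R) :
  affine_point P E u z = P + vec3 (u 0 0) (u 0 1) z *m E.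
Proof.
rewrite /affine_point -!addrA; congr (_ + _).
by apply/rowP => j; rewrite !mxE sum_ord3 !mxE/= !addrA.
Qed.

(** Gathers the parameters and the height into one coordinate vector: a ball for the maximum norm
    lies in the product of the two given neighbourhoods. *)
Lemma local_graph_near S P E f : local_graph S P E f ->
  \forall c \near (0 : 'rV[R]_3), S (P + c *m E) <-> c 0 2 = f (horiz c).
Proof.
move=> [_ [[A B]]] /= [/nbhs_ballP[a /= a0 aA] /nbhs_ballP[b /= b0 bB] AB].
apply/nbhs_ballP; exists (Num.min a b); first by rewrite /= lt_min a0.
move=> c.
rewrite -ball_normE/= sub0r normrN lt_min => /andP[ca cb].
have := AB (horiz c, c 0 2); rewrite /= affine_pointE /horiz vec2_0 vec2_1.
rewrite -vec3_eta; apply; split.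
  apply: aA; rewrite -ball_normE/= sub0r normrN.
  exact: le_lt_trans (horiz_norm c) ca.
apply: bB; rewrite -ball_normE/= sub0r normrN.
exact: le_lt_trans (entry_le_norm _ _ _) cb.
Qed.

Lemma local_graph_0 S P E f : S P -> local_graph S P E f -> f 0 = 0.
Proof.
move=> SP /local_graph_near/nbhs_singleton; rewrite mul0mx addr0 mxE.
rewrite (_ : horiz 0 = 0); first by move=> [h _]; rewrite -h.
by apply/rowP => i; rewrite !mxE; case: ifP.
Qed.

Definition graph_point f (u : 'rV[R]_2) : 'rV[R]_3 :=
  vec3 (u 0 0) (u 0 1) (f u).

Lemma horiz_graph f u : horiz (graph_point f u) = u.
Proof. by rewrite [RHS]vec2_eta /horiz !mxE. Qed.

Lemma graph_point_cvg f : {for 0, continuous f} -> f 0 = 0 ->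
  graph_point f u @[u --> (0 : 'rV[R]_2)] --> (0 : 'rV[R]_3).
Proof.
move=> fc f0; apply: (@cvg_mx 1 3 _ _ (@nbhs_filter _ (0 : 'rV[R]_2))) => i.
rewrite ord1 /graph_point.
have u0 j : (u : 'rV[R]_2) 0 j @[u --> (0 : 'rV[R]_2)] --> (0 : R).
  have -> : (0 : R) = (0 : 'rV[R]_2) 0 j by rewrite mxE.
  exact: differentiable_continuous (@differentiable_coord R 1 2 0 0 j).
elim/forall_ord3; under eq_fun do rewrite mxE/=; rewrite mxE; try exact: u0.
by rewrite -f0; exact: fc.
Qed.

(** [local_graph] speaks only of small heights. Continuity of [f] and [f 0 = 0] bring the points of
    the graph into that range. *)
Lemma local_graph_mem S P E f : S P -> local_graph S P E f ->
  \forall u \near (0 : 'rV[R]_2), S (P + graph_point f u *m E).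
Proof.
move=> SP fg; have f0 := local_graph_0 SP fg.
have fc : {for 0, continuous f}.
  exact/differentiable_continuous/smooth_near_diff/fg.1.
have := graph_point_cvg fc f0 => /(_ _ (local_graph_near fg)).
apply: (@filterS _ (nbhs (0 : 'rV[R]_2))) => u.
by rewrite /preimage/mkset horiz_graph mxE/= => -[_]; apply.
Qed.

(** Points on the graph of [f] lie on [S] and have small height, so the description of [S] by [g]
    applies to them. The choice made in [graph_function] therefore does not affect the germ. *)
Lemma local_graph_unique S P E f g : S P ->
  local_graph S P E f -> local_graph S P E g ->
  \forall u \near (0 : 'rV[R]_2), f u = g u.
Proof.
move=> SP fg gg; have f0 := local_graph_0 SP fg.
have fc : {for 0, continuous f}.
  exact/differentiable_continuous/smooth_near_diff/fg.1.
have := graph_point_cvg fc f0 => /(_ _ (local_graph_near gg)).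
apply: (@filterS2 _ (nbhs (0 : 'rV[R]_2))) (local_graph_mem SP fg) => u Su.
by rewrite /preimage/mkset horiz_graph mxE/= => -[+ _]; apply.
Qed.

Lemma near_eq_pder2 f g p i j : (\forall u \near p, f u = g u) ->
  pder2 i j f p = pder2 i j g p.
Proof.
move=> fg.
apply: (@nbhs_singleton _ p (fun u => pder2 i j f u = pder2 i j g u)).
rewrite /pder2; elim: i => [|i IH] /=; last first.
  by apply: filterS (near_join IH) => u; exact: near_eq_derive.
elim: j => [//|j IH] /=.
by apply: filterS (near_join IH) => u; exact: near_eq_derive.
Qed.

Lemma graph_functionP S P E : adapted_frame S P E ->
  local_graph S P E (graph_function S P E).
Proof.
by move=> [_ [f [fg _]]]; rewrite /graph_function; apply: xgetPex; exists f.
Qed.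

Lemma normal_jet_taylor (d : nat -> nat -> R) :
  (forall x y : R, \sum_(n < 4) ((n`!%:R)^-1 *
     \sum_(i < n.+1) d i (n - i)%N * ('C(n, i))%:R * x ^+ i * y ^+ (n - i)) =
    1 / 2 * (x ^+ 2 + y ^+ 2) + 1 / 6 * (x ^+ 3 - 3 * x * y ^+ 2)) ->
  normal_jet d.
Proof.
move=> H.
have {}H x y : d 0 0 + (d 0%N 1%N * y + d 1%N 0%N * x)
  + (d 0%N 2%N * y ^+ 2 + 2 * d 1%N 1%N * x * y + d 2%N 0%N * x ^+ 2) / 2
  + (d 0%N 3%N * y ^+ 3 + 3 * d 1%N 2%N * x * y ^+ 2
     + 3 * d 2%N 1%N * x ^+ 2 * y + d 3%N 0%N * x ^+ 3) / 6
  = 1 / 2 * (x ^+ 2 + y ^+ 2) + 1 / 6 * (x ^+ 3 - 3 * x * y ^+ 2).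
  have b1 : bump 0 0 = 1%N by [].
  have b2 : bump 0 1 = 2%N by [].
  have b3 : bump 0 2 = 3%N by [].
  have f3 : 3`! = 6%N by [].
  rewrite -H !big_ord_recl !big_ord0 /= !(b1, b2, b3) !(bin0, bin1, binn).
  rewrite (_ : 'C(3, 2) = 3)%N// f3 (_ : 2`! = 2)%N// !subnn !subn0.
  rewrite (_ : 2 - 1 = 1)%N// (_ : 3 - 1 = 2)%N// (_ : 3 - 2 = 1)%N//.
  rewrite fact0 (_ : 1`! = 1)%N// invr1; field => //.
(* A cubic polynomial in two variables has ten coefficients, and its values at these ten points
   determine them. *)
have h1 := H 0 0; have h2 := H 1 0; have h3 := H (-1) 0; have h4 := H 2 0.
have h5 := H 0 1; have h6 := H 0 (-1); have h7 := H 0 2.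
have h8 := H 1 1; have h9 := H 1 (-1); have h10 := H 2 1.
clear H.
by split; split; lra.
Qed.
(** The normal form is given for some graph function; it passes to the chosen one because both have
    the same germ at 0. *)
Lemma graph_function_normal S P E : S P -> adapted_frame S P E ->
  normal_jet (fun i j => pder2 i j (graph_function S P E) 0).
Proof.
move=> SP fr; have gg := graph_functionP fr.
case: fr => _ [f [fg fE]].
have : normal_jet (fun i j => pder2 i j f 0) by exact: normal_jet_taylor.
rewrite /normal_jet.
by rewrite !(near_eq_pder2 _ _ (local_graph_unique SP fg gg)).
Qed.

End Frames.

(** * The structure equation of the moving frame *)

Section Structure.
Context {R : realType}.

Lemma is_derive_mulmx m n p (W : R -> 'M[R]_(m, n)) (dW : 'M[R]_(m, n))
    (A : 'M[R]_(n, p)) (t : R) i j :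
  (forall i j, is_derive t 1 (fun s => W s i j) (dW i j)) ->
  is_derive t 1 (fun s => (W s *m A) i j) ((dW *m A) i j).
Proof.
move=> dWP; rewrite mxE (_ : (fun s => _) =
    \sum_k (fun s => W s i k * A k j)); last first.
  by apply/funext => s; rewrite fct_sumE mxE.
apply: is_derive_sum => k.
have := is_derive_mul (dWP i k) (is_derive_const (A k j) t).
by rewrite mulr0 addr0.
Qed.

Lemma mulmx_continuous m n p (A : 'M[R]_(n, p)) (x : 'M[R]_(m, n)) :
  y *m A @[y --> x] --> x *m A.
Proof.
apply: (@cvg_mx _ m p _ _ (@nbhs_filter _ x)) => i j.
rewrite (_ : (fun y => _) =
    \sum_k (fun y : 'M[R]_(m, n) => y i k * A k j)); last first.
  by apply/funext => y; rewrite fct_sumE mxE.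
have -> : (x *m A) i j = (\sum_k (fun y : 'M[R]_(m, n) => y i k * A k j)) x.
  by rewrite fct_sumE mxE.
apply: differentiable_continuous; apply: differentiable_sum => k.
exact: differentiableM (differentiable_coord _ _ _) (differentiable_cst _ _).
Qed.

Lemma cvg_derivable_row n (w : R -> 'rV[R]_n) (t : R) (dw : 'rV[R]_n) :
  (forall i, is_derive t 1 (fun s => w s 0 i) (dw 0 i)) ->
  w s @[s --> t] --> w t.
Proof.
move=> dwP; apply: (@cvg_mx _ 1 n _ _ (@nbhs_filter _ t)) => i j.
by rewrite ord1; exact: is_derive_continuous (dwP j).
Qed.

Lemma is_derive_row_sub n (w : R -> 'rV[R]_n) (t : R) (q dw : 'rV[R]_n) :
  (forall i, is_derive t 1 (fun s => w s 0 i) (dw 0 i)) ->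
  forall i j, is_derive t 1 (fun s => (w s - q) i j) (dw i j).
Proof.
move=> dwP i j; rewrite ord1; under eq_fun do rewrite !mxE.
have := is_derive_add (dwP j) (is_derive_const (- q 0 j) t).
by rewrite addr0.
Qed.

Lemma mulmx_vec3 (x y z : R) n (A : 'M[R]_(3, n)) j :
  (vec3 x y z *m A) 0 j = x * A 0 j + y * A 1 j + z * A 2 j.
Proof. by rewrite mxE sum_ord3 !mxE. Qed.

Variables (S : set 'rV[R]_3) (e : 'rV[R]_3 -> 'M[R]_3).
Variables (I40 I31 I22 I13 I04 : R).
Hypothesis e_frame : moving_frame S e.
Hypothesis S_curv : has_constant_curvatures S e I40 I31 I22 I13 I04.

Definition connection_mx (v0 v1 : R) : 'M[R]_3 :=
  \matrix_(i, j) connection I40 I31 I22 I13 I04 v0 v1 i j.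

(** The values of [e] off [S] are arbitrary, but along a curve on [S] it coincides with a local
    smooth extension, to which the chain rule applies. *)
Lemma frame_derivable (gamma : R -> 'rV[R]_3) (t0 : R) (dg : 'rV[R]_3) :
  (forall i, is_derive t0 1 (fun t => gamma t 0 i) (dg 0 i)) ->
  (\forall t \near t0, S (gamma t)) ->
  exists dE : 'M[R]_3,
    forall i j, is_derive t0 1 (fun t => e (gamma t) i j) (dE i j).
Proof.
move=> dgP Sg; have Sg0 := nbhs_singleton Sg.
have [F [Fs Fe]] := e_frame.2 _ Sg0.
exists (\matrix_(i, j)
  \sum_k pder k (fun Q => F Q i j) (gamma t0) * dg 0 k) => i j; rewrite mxE.
apply: (@near_eq_is_derive _ _ _ (fun t => F (gamma t) i j)).
  have := cvg_derivable_row dgP => /(_ _ Fe) Feg.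
  apply: (@filterS2 _ (nbhs t0)) Sg Feg => t St.
  by rewrite /preimage/mkset => ->.
exact: is_derive_comp_row (smooth_near_diff (Fs i j)) dgP.
Qed.

Lemma structure_equation (gamma : R -> 'rV[R]_3) (t0 : R) (dg : 'rV[R]_3) :
  (forall i, is_derive t0 1 (fun t => gamma t 0 i) (dg 0 i)) ->
  (\forall t \near t0, S (gamma t)) ->
  exists v0 v1 : R, dg = vec3 v0 v1 0 *m e (gamma t0) /\
    forall i j, is_derive t0 1 (fun t => e (gamma t) i j)
      ((connection_mx v0 v1 *m e (gamma t0)) i j).
Proof.
move=> dgP Sg; have SQ := nbhs_singleton Sg.
set Q := gamma t0; set M := e Q.
have [uM _] := e_frame.1 _ SQ; rewrite -/Q -/M in uM SQ.
have fg := graph_functionP (e_frame.1 _ SQ).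
rewrite -/M in fg; set f := graph_function S Q M in fg.
have fs : smooth_near f 0 := fg.1.
pose c t := (gamma t - Q) *m invmx M; pose dc := dg *m invmx M.
have cM t : Q + c t *m M = gamma t by rewrite /c mulmxKV// addrC subrK.
have c0 : c t0 = 0 by rewrite /c subrr mul0mx.
have dcP i : is_derive t0 1 (fun t => c t 0 i) (dc 0 i).
  by apply: is_derive_mulmx; exact: is_derive_row_sub.
have cc : c t @[t --> t0] --> (0 : 'rV[R]_3).
  by rewrite -c0; exact: cvg_derivable_row dcP.
have h0 : vec2 (c t0 0 0) (c t0 0 1) = 0 by rewrite c0 !mxE vec2_00.
have c2 : \forall t \near t0, c t 0 2 = f (vec2 (c t 0 0) (c t 0 1)).
  have := cc _ (local_graph_near fg).
  apply: (@filterS2 _ (nbhs t0)) Sg => t St.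
  by rewrite /preimage/mkset cM => -[h _]; exact: h.
have nf := graph_function_normal SQ (e_frame.1 _ SQ).
rewrite -/M -/f in nf.
(* The first derivatives of [f] vanish at 0: the first two frame vectors span the tangent plane, so
   the velocity has no third component. *)
have dc2 : dc 0 2 = 0.
  have df : is_derive t0 1 (fun t => f (vec2 (c t 0 0) (c t 0 1)))
     (pder2 1 0 f 0 * dc 0 0 + pder2 0 1 f 0 * dc 0 1).
    have := @is_derive_pder2 _ f 0 0 _ _ _ _ _ _ (dcP 0) (dcP 1).
    by rewrite h0; apply.
  rewrite (near_eq_is_derive_unique c2 (dcP 2) df).
  by case: nf => -[_ -> -> _ _] _; rewrite !mul0r addr0.
exists (dc 0 0), (dc 0 1); split.
  by rewrite -dc2 -vec3_eta mulmxKV.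
have [dE dEP] := frame_derivable dgP Sg.
pose m i j t := (e (gamma t) *m invmx M) i j.
have dmP i j : is_derive t0 1 (m i j) ((dE *m invmx M) i j).
  exact: is_derive_mulmx.
pose d i j t := pder2 i j f (vec2 (c t 0 0) (c t 0 1)).
have ddP i j : is_derive t0 1 (d i j)
    (d i.+1 j t0 * dc 0 0 + d i j.+1 t0 * dc 0 1).
  by apply: is_derive_pder2 (dcP 0) (dcP 1); rewrite h0.
have d0 i j : d i j t0 = pder2 i j f 0 by rewrite /d h0.
have m0 i j : m i j t0 = (i == j)%:R by rewrite /m mulmxV// mxE.
have [C40 C31 C22 C13 C04] := S_curv SQ.
have -> : connection_mx (dc 0 0) (dc 0 1) = dE *m invmx M; last first.
  by rewrite mulmxKV.
apply/matrixP => i j; rewrite mxE; apply/esym; move: i j.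
apply: (linearization ddP dmP _ _ _ _ _ _ m0).
- by rewrite /normal_jet !d0.
- by rewrite d0.
- by rewrite d0.
- by rewrite d0.
- by rewrite d0.
- by rewrite d0.
(* It remains to obtain [jet_eq] for [t] near [t0]. There the description of [S] by [f] holds on a
   whole neighbourhood of [c t]. *)
have Sg' : \forall t \near t0, \forall c' \near c t,
    S (Q + c' *m M) <-> c' 0 2 = f (horiz c').
  by have := cc _ (near_join (local_graph_near fg)).
have fs' : \forall t \near t0, smooth_near f (vec2 (c t 0 0) (c t 0 1)).
  have lim : vec2 (c t 0 0) (c t 0 1) @[t --> t0] -->
      vec2 (c t0 0 0) (c t0 0 1).
    exact: continuous_vec2 (is_derive_continuous (dcP 0))
      (is_derive_continuous (dcP 1)).
  by rewrite h0 in lim; exact: lim _ (smooth_near_near fs).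
near=> t => k0 k1.
have St : S (gamma t) by near: t.
have ft : smooth_near f (vec2 (c t 0 0) (c t 0 1)) by near: t.
have ct2 : c t 0 2 = f (vec2 (c t 0 0) (c t 0 1)) by near: t.
have gt : \forall c' \near c t, S (Q + c' *m M) <-> c' 0 2 = f (horiz c').
  by near: t.
have frt := e_frame.1 _ St.
have gg := graph_functionP frt; set g := graph_function _ _ _ in gg.
have gs : smooth_near g 0 := gg.1.
have ng := graph_function_normal St frt; rewrite -/g in ng.
apply: (@jet_transfer R f g _ _ (fun i j => m i j t)).
- exact: ft.
- by rewrite vec2_00.
- by rewrite vec2_00.
rewrite vec2_00.
have gc : {for 0, continuous g}.
  exact/differentiable_continuous/smooth_near_diff.
have := graph_point_cvg gc (local_graph_0 St gg).
pose mt := e (gamma t) *m invmx M.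
move=> gp0.
have gm : graph_point g h *m mt @[h --> (0 : 'rV[R]_2)] --> (0 : 'rV[R]_3).
  rewrite -[X in _ --> X](mul0mx _ mt).
  exact: (cvg_comp _ _ gp0 (@mulmx_continuous _ _ _ mt 0)).
(* A point with coordinates [graph_point g h] in the frame at [gamma t] has these coordinates in the
   frame [M] at [Q]. For small [h] they lie where [f] describes [S], which yields the identity
   between [f] and [g] required by [jet_transfer]. *)
have : c t + graph_point g h *m mt @[h --> (0 : 'rV[R]_2)] --> c t.
  rewrite -[X in _ --> X]addr0.
  exact: (@cvgD _ _ _ (nbhs (0 : 'rV[R]_2)) _ (fun=> c t) _ _ _ (cvg_cst _) gm).
move=> /(_ _ gt).
apply: (@filterS2 _ (nbhs (0 : 'rV[R]_2))) (local_graph_mem St gg) => h Sh.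
rewrite /preimage/mkset mulmxDl addrA cM -mulmxA mulmxKV// => -[+ _].
move=> /(_ Sh).
have mE j : (c t + graph_point g h *m mt) 0 j =
    c t 0 j + (h 0 0 * m 0 j t + h 0 1 * m 1 j t) + g h * m 2 j t.
  by rewrite mxE mulmx_vec3 addrA.
by rewrite /horiz !mE ct2.
Unshelve. all: by end_near. Qed.

End Structure.

(** * Uniqueness along rays *)

Section Rays.
Context {R : realType}.
Variables (I40 I31 I22 I13 I04 : R).
Local Notation conn := (connection_mx I40 I31 I22 I13 I04).

(* The equations satisfied along t |-> t v by the height z and the frame N of
   the surface, in the coordinates of the frame at the base point. *)
Definition ray_system (v : 'rV[R]_2) (z : R -> R) (N : R -> 'M[R]_3) : Prop :=
  [/\ z 0 = 0, N 0 = 1%:M & forall t : R, t \in `[0, 1] ->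
    `|N t - 1%:M| <= 4^-1 /\
    exists w0 w1 b : R,
      [/\ vec3 (v 0 0) (v 0 1) b = vec3 w0 w1 0 *m N t,
          is_derive t 1 z b &
          forall i j, is_derive t 1 (fun s => N s i j)
            ((conn w0 w1 *m N t) i j)]].

Lemma connectionB (a b c d : R) : conn a b - conn c d = conn (a - c) (b - d).
Proof.
apply/matrixP; apply: forall_ord3; apply: forall_ord3;
  rewrite !mxE /connection/=; field => //.
Qed.

Lemma connection_bound : exists2 C : R, 0 < C &
  forall a b i j, `|conn a b i j| <= C * (`|a| + `|b|).
Proof.
(* The entries are linear in [(a, b)]; the summand 1 only makes the constant positive. *)
exists (`|conn 1 0| + `|conn 0 1| + 1); first by rewrite ltr_wpDl// addr_ge0.
move=> a b i j.
have -> : conn a b i j = a * conn 1 0 i j + b * conn 0 1 i j.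
  move: i j; apply: forall_ord3; apply: forall_ord3;
  rewrite !mxE /connection/=; field => //.
apply: le_trans (ler_normD _ _) _; rewrite !normrM mulrDr.
have n1 := entry_le_norm (conn 1 0) i j.
have n2 := entry_le_norm (conn 0 1) i j.
have p1 := normr_ge0 (conn 1 0); have p2 := normr_ge0 (conn 0 1).
by rewrite lerD// mulrC ler_wpM2r//; lra.
Qed.

(** The 2 by 2 block is within 1/4 of the identity in each entry. Solving each equation for its
    diagonal unknown and adding gives [W <= V + W / 2], where [W] and [V] are the two sums of
    absolute values. *)
Lemma frame_speed_bound (n00 n01 n10 n11 w0 w1 v0 v1 : R) :
  `|n00 - 1| <= 4^-1 -> `|n01| <= 4^-1 -> `|n10| <= 4^-1 ->
  `|n11 - 1| <= 4^-1 ->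
  v0 = w0 * n00 + w1 * n10 -> v1 = w0 * n01 + w1 * n11 ->
  `|w0| + `|w1| <= 2 * (`|v0| + `|v1|).
Proof.
move=> h00 h01 h10 h11 e0 e1.
have b0 : `|w0| <= `|v0| + 4^-1 * (`|w0| + `|w1|).
  have {1}-> : w0 = v0 - (w0 * (n00 - 1) + w1 * n10) by rewrite e0; ring.
  apply: le_trans (ler_normB _ _) _; rewrite lerD2l.
  apply: le_trans (ler_normD _ _) _; rewrite !normrM mulrDr.
  by apply: lerD; rewrite mulrC ler_wpM2r.
have b1 : `|w1| <= `|v1| + 4^-1 * (`|w0| + `|w1|).
  have {1}-> : w1 = v1 - (w0 * n01 + w1 * (n11 - 1)) by rewrite e1; ring.
  apply: le_trans (ler_normB _ _) _; rewrite lerD2l.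
  apply: le_trans (ler_normD _ _) _; rewrite !normrM mulrDr.
  by apply: lerD; rewrite mulrC ler_wpM2r.
lra.
Qed.

(** The difference of the two [w] satisfies the linear system of [N] with right-hand side
    [- w' (N - N')]. As [w'] has size at most [2 V], [frame_speed_bound] bounds this difference by
    [8 V |N - N'|]. The constants are then [10 = 8 + 2] and, for sums of three products with entries
    of [N] at most 2, [54 = 3 * 16 + 3 * 2]. *)
Lemma ray_speed_diff (C : R) (v : 'rV[R]_2) (N N' : 'M[R]_3)
    (w0 w1 b w0' w1' b' : R) : 0 < C ->
  (forall a b i j, `|conn a b i j| <= C * (`|a| + `|b|)) ->
  `|N - 1%:M| <= 4^-1 -> `|N' - 1%:M| <= 4^-1 ->
  vec3 (v 0 0) (v 0 1) b = vec3 w0 w1 0 *m N ->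
  vec3 (v 0 0) (v 0 1) b' = vec3 w0' w1' 0 *m N' ->
  `|b - b'| <= 10 * `|N - N'| * (`|v 0 0| + `|v 0 1|) /\
  forall i j, `|(conn w0 w1 *m N) i j - (conn w0' w1' *m N') i j| <=
    54 * C * (`|v 0 0| + `|v 0 1|) * `|N - N'|.
Proof.
move=> C0 Cb hN hN' e e'.
pose D := N - N'.
have Nb A i j : `|A - 1%:M : 'M[R]_3| <= 4^-1 -> `|A i j - (i == j)%:R| <= 4^-1.
  move=> h; apply: le_trans h; have := entry_le_norm (A - 1%:M) i j.
  by rewrite !mxE.
have ev j : vec3 (v 0 0) (v 0 1) b 0 j = w0 * N 0 j + w1 * N 1 j.
  by rewrite e mulmx_vec3 mul0r addr0.
have ev' j : vec3 (v 0 0) (v 0 1) b' 0 j = w0' * N' 0 j + w1' * N' 1 j.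
  by rewrite e' mulmx_vec3 mul0r addr0.
have v0E : v 0 0 = w0 * N 0 0 + w1 * N 1 0 by rewrite -ev mxE.
have v1E : v 0 1 = w0 * N 0 1 + w1 * N 1 1 by rewrite -ev mxE.
have bE : b = w0 * N 0 2 + w1 * N 1 2 by rewrite -ev mxE.
have v0E' : v 0 0 = w0' * N' 0 0 + w1' * N' 1 0 by rewrite -ev' mxE.
have v1E' : v 0 1 = w0' * N' 0 1 + w1' * N' 1 1 by rewrite -ev' mxE.
have bE' : b' = w0' * N' 0 2 + w1' * N' 1 2 by rewrite -ev' mxE.
have h00 := Nb _ 0 0 hN; have h01 := Nb _ 0 1 hN; have h02 := Nb _ 0 2 hN.
have h10 := Nb _ 1 0 hN; have h11 := Nb _ 1 1 hN; have h12 := Nb _ 1 2 hN.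
rewrite /= ?subr0 in h00 h01 h02 h10 h11 h12.
have k00 := Nb _ 0 0 hN'; have k01 := Nb _ 0 1 hN'.
have k10 := Nb _ 1 0 hN'; have k11 := Nb _ 1 1 hN'.
rewrite /= ?subr0 in k00 k01 k10 k11.
set V := `|v 0 0| + `|v 0 1|.
have V0 : 0 <= V by rewrite addr_ge0.
have w'b : `|w0'| + `|w1'| <= 2 * V.
  exact: frame_speed_bound k00 k01 k10 k11 v0E' v1E'.
have m0 : 0 <= `|D| by [].
have DE i j : N i j - N' i j = D i j by rewrite !mxE.
have comp j : `|w0' * D 0 j + w1' * D 1 j| <= 2 * V * `|D|.
  apply: le_trans (ler_normD _ _) _; rewrite !normrM.
  apply: (@le_trans _ _ ((`|w0'| + `|w1'|) * `|D|)); last exact: ler_wpM2r.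
  by rewrite mulrDl lerD// ler_wpM2l// entry_le_norm.
have dw : `|w0 - w0'| + `|w1 - w1'| <= 8 * V * `|D|.
  have := @frame_speed_bound _ _ _ _ (w0 - w0') (w1 - w1')
    (- (w0' * D 0 0 + w1' * D 1 0)) (- (w0' * D 0 1 + w1' * D 1 1))
    h00 h01 h10 h11.
  rewrite !normrN => /(_ _ _)/wrap[].
  - move: v0E; rewrite v0E' => v0E; rewrite -!DE.
    have : w0' * N' 0 0 + w1' * N' 1 0 - (w0 * N 0 0 + w1 * N 1 0) = 0.
      by rewrite -v0E subrr.
    by move=> h; apply/eqP; rewrite -subr_eq0; apply/eqP; rewrite -h; ring.
  - move: v1E; rewrite v1E' => v1E; rewrite -!DE.
    have : w0' * N' 0 1 + w1' * N' 1 1 - (w0 * N 0 1 + w1 * N 1 1) = 0.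
      by rewrite -v1E subrr.
    by move=> h; apply/eqP; rewrite -subr_eq0; apply/eqP; rewrite -h; ring.
  have c0 := comp 0; have c1 := comp 1; lra.
split.
  have -> : b - b' = (w0 - w0') * N 0 2 + (w1 - w1') * N 1 2 +
      (w0' * D 0 2 + w1' * D 1 2) by rewrite bE bE' -!DE; ring.
  apply: le_trans (ler_normD _ _) _; have c2 := comp 2.
  suff : `|(w0 - w0') * N 0 2 + (w1 - w1') * N 1 2| <= 8 * V * `|D|.
    rewrite -/D; lra.
  apply: le_trans (ler_normD _ _) _; rewrite !normrM.
  apply: le_trans dw; apply: lerD; rewrite ler_piMr//; lra.
move=> i j.
have -> : (conn w0 w1 *m N) i j - (conn w0' w1' *m N') i j =
    (conn (w0 - w0') (w1 - w1') *m N) i j + (conn w0' w1' *m D) i j.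
  rewrite -connectionB /D mulmxBl mulmxBr; rewrite !mxE.
  by rewrite addrA subrK.
have Nij k : `|N k j| <= 2.
  have -> : N k j = (N k j - (k == j)%:R) + (k == j)%:R by rewrite subrK.
  apply: le_trans (ler_normD _ _) _; have := Nb _ k j hN.
  have : `|(k == j)%:R : R| <= 1 by case: (k == j); rewrite ?normr1 ?normr0.
  lra.
have A1 : `|(conn (w0 - w0') (w1 - w1') *m N) i j| <= 48 * C * V * `|D|.
  rewrite mxE; apply: le_trans (ler_norm_sum _ _ _) _.
  have step k : `|conn (w0 - w0') (w1 - w1') i k * N k j| <= 16 * C * V * `|D|.
    rewrite normrM.
    rewrite (_ : 16 * C * V * `|D| = (C * (8 * V * `|D|)) * 2); last by ring.
    apply: ler_pM => //; apply: le_trans (Cb _ _ _ _) _.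
    by rewrite ler_wpM2l// ltW.
  apply: le_trans (ler_sum _ (fun k _ => step k)) _.
  by rewrite sumr_const card_ord -mulr_natl; lra.
have A2 : `|(conn w0' w1' *m D) i j| <= 6 * C * V * `|D|.
  rewrite mxE; apply: le_trans (ler_norm_sum _ _ _) _.
  have step k : `|conn w0' w1' i k * D k j| <= 2 * C * V * `|D|.
    rewrite normrM (_ : 2 * C * V * `|D| = (C * (2 * V)) * `|D|); last by ring.
    apply: ler_pM => //; last exact: entry_le_norm.
    by apply: le_trans (Cb _ _ _ _) _; rewrite ler_wpM2l// ltW.
  apply: le_trans (ler_sum _ (fun k _ => step k)) _.
  by rewrite sumr_const card_ord -mulr_natl; lra.
apply: le_trans (ler_normD _ _) _; rewrite -/D; lra.
Qed.

Lemma ray_system_unique : exists2 d : R, 0 < d & forall v z z' N N',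
  `|v| < d -> ray_system v z N -> ray_system v z' N' -> z 1 = z' 1.
Proof.
have [C C0 Cb] := connection_bound.
(* With this radius [V] is at most [2 / (216 C)], so the Lipschitz constant [L = 54 C V] is at most
   1/2. *)
exists (216 * C)^-1; first by rewrite invr_gt0 mulr_gt0.
move=> v z z' N N' vd [z0 N0 sys] [z0' N0' sys'].
set V := `|v 0 0| + `|v 0 1|.
pose L := 54 * C * V.
have V0 : 0 <= V by rewrite addr_ge0.
have Vd : V <= 2 * (216 * C)^-1.
  have := entry_le_norm v 0 0; have := entry_le_norm v 0 1; rewrite /V; lra.
have L1 : L <= 1 / 2.
  rewrite /L (_ : 1 / 2 = 54 * C * (2 * (216 * C)^-1)); last first.
    by field; rewrite gt_eqF.
  by rewrite ler_wpM2l// mulr_ge0// ltW.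
pose D (t : R) : 'M[R]_3 := N t - N' t.
have subE (A B : 'M[R]_3) i j : (A - B) i j = A i j - B i j.
  by rewrite !mxE.
have dif (t : R) : t \in `[0, 1] -> exists db : R, exists dD : 'M[R]_3,
    [/\ is_derive t 1 (fun s => z s - z' s) db,
        forall i j, is_derive t 1 (fun s => D s i j) (dD i j),
        `|db| <= 10 * `|D t| * V & forall i j, `|dD i j| <= L * `|D t|].
  move=> t01; have [hN [w0 [w1 [b [e dz dN]]]]] := sys t t01.
  have [hN' [w0' [w1' [b' [e' dz' dN']]]]] := sys' t t01.
  have [A B] := ray_speed_diff C0 Cb hN hN' e e'.
  exists (b - b'), (conn w0 w1 *m N t - conn w0' w1' *m N' t); split => //.
  - exact: is_deriveB.
  - move=> i j; rewrite /D; under eq_fun do rewrite subE.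
    rewrite subE.
    exact: (@is_deriveB _ _ _ (fun s => N s i j) (fun s => N' s i j)).
  - by move=> i j; rewrite subE; exact: B.
have Dc : {within `[0, 1], continuous (fun t => `|D t|)}.
  apply/continuous_in_subspaceT => t /[1!inE] t01.
  have [db [dD [_ dDP _ _]]] := dif t t01.
  apply: cvg_norm; apply/differentiable_continuous/derivable1_diffP.
  by apply/derivable_mxP => i j; have [] := dDP i j.
have [c c01 cmax] := EVT_max ler01 Dc.
have c0 : 0 <= c by move: c01; rewrite in_itv/= => /andP[].
have c1 : c <= 1 by move: c01; rewrite in_itv/= => /andP[].
have sub (t : R) : t \in `[0, c] -> t \in `[0, 1].
  by rewrite !in_itv/= => /andP[-> tc]; exact: le_trans tc c1.
have D0 : D 0 = 0 by rewrite /D N0 N0' subrr.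
(* The mean value theorem bounds D c by the maximum of its derivative, which is
   at most L times the maximum of D itself; as L < 1, D vanishes. *)
have Dle : `|D c| <= L * `|D c|.
  rewrite {1}/Num.Def.normr/= mx_normrE; apply/bigmax_le.
    by rewrite !mulr_ge0// ltW.
  move=> [i j] _ /=.
  have dd (t : R) : t \in `[0, c] -> derivable (fun s => D s i j) t 1.
    by move=> /sub/dif[db [dD [_ /(_ i j)[] //]]].
  have [||x xc] := @MVT_segment R (fun s => D s i j)
    (fun t => 'D_1 (fun s => D s i j) t) 0 c c0.
  - by move=> x /subset_itv_oo_cc/dd/derivableP.
  - by apply: derivable_within_continuous => x; exact: dd.
  have D0ij : D 0 i j = 0 by rewrite D0 mxE.
  rewrite D0ij !subr0 => ->.
  have [db [dD [_ /(_ i j)[_ ->] _ /(_ i j) dDle]]] := dif x (sub _ xc).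
  rewrite normrM (ger0_norm c0).
  apply: le_trans (ler_piMr _ c1) _ => //.
  apply: le_trans dDle _; rewrite ler_wpM2l//; first by rewrite !mulr_ge0// ltW.
  exact: cmax (sub _ xc).
have Dz : `|D c| = 0.
  apply/eqP; rewrite eq_le normr_ge0 andbT.
  have : L * `|D c| <= 1 / 2 * `|D c| by rewrite ler_wpM2r.
  lra.
have dd (t : R) : t \in `[0, 1] -> derivable (fun s => z s - z' s) t 1.
  by move=> /dif[db [dD [[]]]].
(* Since [D] vanishes on the whole interval, the bound on the derivative of [z - z'] is zero, and
   the heights agree at time 1. *)
have [||x xc] := @MVT_segment R (fun s => z s - z' s)
    (fun t => 'D_1 (fun s => z s - z' s) t) 0 1 ler01.
- by move=> x /subset_itv_oo_cc/dd/derivableP.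
- by apply: derivable_within_continuous => x; exact: dd.
rewrite z0 z0' !subr0 mulr1 => E.
have [db [dD [[_ dbE] _ dble _]]] := dif x xc.
rewrite dbE in E.
have Dx : `|D x| = 0.
  by apply/eqP; rewrite eq_le normr_ge0 andbT -Dz; exact: cmax.
move: dble; rewrite Dx mulr0 mul0r -E normr_le0 subr_eq0.
by move/eqP.
Qed.

End Rays.

(** * Rays on a surface with constant curvatures *)

Section SurfaceRays.
Context {R : realType}.

Lemma near0_ball n (A : 'rV[R]_n -> Prop) :
  (\forall u \near (0 : 'rV[R]_n), A u) ->
  exists2 d : R, 0 < d & forall u, `|u| < d -> A u.
Proof.
move=> /nbhs_ballP[d /= d0 dA]; exists d => // u ud; apply: dA.
by rewrite -ball_normE/= sub0r normrN.
Qed.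

Variables (S : set 'rV[R]_3) (e : 'rV[R]_3 -> 'M[R]_3).
Variables (I40 I31 I22 I13 I04 : R).
Hypothesis e_frame : moving_frame S e.
Hypothesis S_curv : has_constant_curvatures S e I40 I31 I22 I13 I04.

(** This is the structure equation along the curve of [S] above the ray. Passing to the basis [e P]
    multiplies the frame on the right by a constant matrix, which leaves the connection matrix on
    its left unchanged. *)
Lemma surface_rays (P : 'rV[R]_3) (f := graph_function S P (e P)) : S P ->
  exists2 d : R, 0 < d & forall v, `|v| < d ->
    ray_system I40 I31 I22 I13 I04 v (fun t => f (t *: v))
      (fun t => e (P + graph_point f (t *: v) *m e P) *m invmx (e P)).
Proof.
move=> SP; have fr := e_frame.1 _ SP; have [uE _] := fr.
have fg : local_graph S P (e P) f := graph_functionP fr.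
set E := e P in fg uE *.
have fs : smooth_near f 0 := fg.1.
have f0 := local_graph_0 SP fg.
have gp : graph_point f u @[u --> (0 : 'rV[R]_2)] --> (0 : 'rV[R]_3).
  exact/graph_point_cvg/f0/differentiable_continuous/smooth_near_diff.
pose X (u : 'rV[R]_2) : 'rV[R]_3 := P + graph_point f u *m E.
have XP : X u @[u --> (0 : 'rV[R]_2)] --> P.
  have gm : graph_point f u *m E @[u --> (0 : 'rV[R]_2)] --> (0 : 'rV[R]_3).
    rewrite -[X in _ --> X](mul0mx _ E).
    exact: (cvg_comp _ _ gp (@mulmx_continuous _ _ _ _ E 0)).
  rewrite -[X in _ --> X]addr0.
  exact: (@cvgD _ _ _ (nbhs (0 : 'rV[R]_2)) _ (fun=> P) _ _ _ (cvg_cst _) gm).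
have SX : \forall u \near (0 : 'rV[R]_2), S (X u) := local_graph_mem SP fg.
(* Continuity of the frame is available only through a smooth extension [F], which agrees with [e]
   at the points [X u] of [S]. *)
have eX : \forall u \near (0 : 'rV[R]_2), `|e (X u) *m invmx E - 1%:M| <= 4^-1.
  have [F [Fs Fe]] := e_frame.2 _ SP.
  have FX : F (X u) *m invmx E @[u --> (0 : 'rV[R]_2)] --> (1%:M : 'M[R]_3).
    have -> : 1%:M = F P *m invmx E by rewrite (nbhs_singleton Fe SP) mulmxV.
    have FP : F (X u) @[u --> (0 : 'rV[R]_2)] --> F P.
      apply: (@cvg_mx _ 3 3 _ _ (@nbhs_filter _ (0 : 'rV[R]_2))) => i j.
      exact: (@cvg_comp _ _ _ X (fun Q => F Q i j) _ _ _ XP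
        (differentiable_continuous (smooth_near_diff (Fs i j)))).
    exact: (cvg_comp _ _ FP (@mulmx_continuous _ _ _ _ (invmx E) _)).
  have q : 0 < 4^-1 :> R by [].
  move/(@cvgrPdist_le R) : FX => /(_ _ q) FX.
  apply: (@filterS3 _ (nbhs (0 : 'rV[R]_2))) SX (XP _ Fe) FX => u Su.
  by rewrite /preimage/mkset => /(_ Su) -> ; rewrite distrC.
(* One ball in which [X] stays on [S] near every parameter, [f] is smooth and the frame is within
   1/4 of the base frame. It contains the whole segment from 0 to each of its points. *)
have := @near0_ball 2 _
  (filterI (near_join SX) (filterI (smooth_near_near fs) eX)).
case=> d d0 dP; exists d => // v vd; split.
- by rewrite scale0r.
- rewrite scale0r (_ : graph_point f 0 = 0) ?mul0mx ?addr0 ?mulmxV//.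
  by rewrite /graph_point f0 [RHS]vec3_eta !mxE.
move=> t; rewrite in_itv/= => /andP[t0 t1].
have tv : `|t *: v| < d.
  by apply: le_lt_trans vd; rewrite normrZ ger0_norm// ler_piMl.
have [SXt [ft et]] := dP _ tv; split; first exact: et.
pose b := 'D_v f (t *: v).
have dfb : is_derive t 1 (fun s => f (s *: v)) b.
  have := @is_derive_line R 2 f 0 v t.
  rewrite add0r (_ : (fun s : R => f (0 + s *: v)) = fun s => f (s *: v)).
    by apply; exact: smooth_near_diff.
  by apply/funext => s; rewrite add0r.
pose dg := vec3 (v 0 0) (v 0 1) b *m E.
have dX i : is_derive t 1 (fun s => X (s *: v) 0 i) (dg 0 i).
  have dgp k : is_derive t 1 (fun s => graph_point f (s *: v) 0 k)
      (vec3 (v 0 0) (v 0 1) b 0 k).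
    move: k; elim/forall_ord3; under eq_fun do rewrite !mxE/=; rewrite mxE//=.
    + have := is_derive_mul (is_derive_id t 1) (is_derive_const (v 0 0) t).
      by rewrite mul1r mulr0 addr0.
    + have := is_derive_mul (is_derive_id t 1) (is_derive_const (v 0 1) t).
      by rewrite mul1r mulr0 addr0.
  have dgpE : is_derive t 1
      (fun s => (graph_point f (s *: v) *m E) 0 i) (dg 0 i).
    by apply: is_derive_mulmx => k j; rewrite ord1; exact: dgp.
  have := is_derive_add (is_derive_const (P 0 i) t) dgpE.
  rewrite add0r; congr is_derive; apply/funext => s.
  by rewrite [RHS]mxE.
have SXv : \forall s \near t, S (X (s *: v)).
  have : s *: v @[s --> t] --> t *: v by exact: scalel_continuous.
  by move=> /(_ _ SXt).
have [w0 [w1 [dgE dE]]] := structure_equation e_frame S_curv dX SXv.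
exists w0, w1, b; split => //.
  by rewrite mulmxA -dgE /dg mulmxK.
move=> i j; rewrite mulmxA; exact: is_derive_mulmx.
Qed.

Lemma frame_coordinates_near n p (P : 'rV[R]_n) (A : 'M[R]_(n, p)) (r : R) :
  0 < r -> \forall Q \near P, `|(Q - P) *m A| < r.
Proof.
move=> r0; have /(@cvgrPdist_lt R)/(_ r r0) := @mulmx_continuous R _ _ _ A P.
by apply: (@filterS _ (nbhs P)) => Q; rewrite distrC mulmxBl.
Qed.

End SurfaceRays.

(** * Affine congruence of the two surfaces *)

Theorem theorem5p3 (R : realType) (S S' : set 'rV[R]_3)
    (e e' : 'rV[R]_3 -> 'M[R]_3) (I40 I31 I22 I13 I04 : R)
    (S_reg : regular_elliptical S) (S'_reg : regular_elliptical S')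
    (e_frame : moving_frame S e) (e'_frame : moving_frame S' e')
    (S_curv : has_constant_curvatures S e I40 I31 I22 I13 I04)
    (S'_curv : has_constant_curvatures S' e' I40 I31 I22 I13 I04)
    (P P' : 'rV[R]_3) (SP : S P) (SP' : S' P') :
  exists (U U' : set 'rV[R]_3) (T : 'rV[R]_3 -> 'rV[R]_3),
    [/\ nbhs_in S P U, nbhs_in S' P' U', affine_transformation T,
        T P = P' & T @` U = U'].
Proof.
have [uE _] := e_frame.1 _ SP; have [uE' _] := e'_frame.1 _ SP'.
have fg := graph_functionP (e_frame.1 _ SP).
have fg' := graph_functionP (e'_frame.1 _ SP').
have [d d0 rays] := surface_rays e_frame S_curv SP.
have [d' d'0 rays'] := surface_rays e'_frame S'_curv SP'.
set f := graph_function S P (e P) in fg rays.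
set f' := graph_function S' P' (e' P') in fg' rays'.
set E := e P in uE fg rays; set E' := e' P' in uE' fg' rays'.
have [d2 d20 uniq] := @ray_system_unique R I40 I31 I22 I13 I04.
have [r1 r10 Sf] := near0_ball (local_graph_near fg).
have [r2 r20 Sf'] := near0_ball (local_graph_near fg').
have [r [r0 rf rS rS']] : exists r : R, [/\ 0 < r,
    forall u, `|u| < r -> f u = f' u,
    forall c, `|c| < r -> S (P + c *m E) <-> c 0 2 = f (horiz c) &
    forall c, `|c| < r -> S' (P' + c *m E') <-> c 0 2 = f' (horiz c)].
  exists (Num.min (Num.min d d') (Num.min d2 (Num.min r1 r2))); split.
  - by rewrite !lt_min d0 d'0 d20 r10.
  (* The heights along the ray with direction [u] are [f u] and [f' u] at time 1, so uniqueness
     along rays gives their equality. *)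
  - move=> u; rewrite !lt_min => /andP[/andP[ud ud'] /andP[ud2 _]].
    have := uniq _ _ _ _ _ ud2 (rays _ ud) (rays' _ ud').
    by rewrite scale1r.
  - by move=> c; rewrite !lt_min => /and3P[_ _ /andP[/Sf]].
  - by move=> c; rewrite !lt_min => /and3P[_ _ /andP[_ /Sf']].
(* In row-vector convention, the linear part sends each row of [E] to the same row of [E'], and the
   translation sends [P] to [P']. Thus [T] preserves coordinates in the two frames. *)
pose T (Q : 'rV[R]_3) := Q *m (invmx E *m E') + (P' - P *m (invmx E *m E')).
have TE c : T (P + c *m E) = P' + c *m E'.
  have cA : c *m E *m (invmx E *m E') = c *m E' by rewrite mulmxA mulmxK.
  by rewrite /T mulmxDl cA addrC addrA subrK.
pose U : set 'rV[R]_3 := [set Q | S Q /\ `|(Q - P) *m invmx E| < r].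
have UE Q : Q = P + (Q - P) *m invmx E *m E by rewrite mulmxKV// addrC subrK.
have UE' Q : Q = P' + (Q - P') *m invmx E' *m E'.
  by rewrite mulmxKV// addrC subrK.
(* With the image as second neighbourhood, it remains to see that it lies in [S'] and contains every
   point of [S'] whose coordinates at [P'] have norm below [r]. Both follow from [f = f'] on that
   range. *)
exists U, (T @` U), T; split => //.
- split=> [Q []//|]; rewrite /within/=.
  have := frame_coordinates_near P (invmx E) r0.
  by apply: (@filterS _ (nbhs P)) => Q Qr SQ; split.
- split=> [_ [Q [SQ Qr] <-]|].
    rewrite [Q]UE TE rS'// -rf; last exact: le_lt_trans (horiz_norm _) Qr.
    by apply/(rS _ Qr); rewrite -UE.
  rewrite /within/=; have := frame_coordinates_near P' (invmx E') r0.
  apply: (@filterS _ (nbhs P')) => Q Qr SQ.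
  exists (P + (Q - P') *m invmx E' *m E); last by rewrite TE -UE'.
  split; last by rewrite [P + _]addrC addrK mulmxK.
  rewrite rS// rf; last exact: le_lt_trans (horiz_norm _) Qr.
  by apply/(rS' _ Qr); rewrite -UE'.
- exists (invmx E *m E'), (P' - P *m (invmx E *m E')); split=> //.
  by rewrite unitmx_mul unitmx_inv uE uE'.
- by have := TE 0; rewrite !mul0mx !addr0.
Qed.
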